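(* The $L^1$ Dirac-Hardy inequality fails: there is no constant $C>0$ such that $$\int_{\mathbb{R}^3} \frac{|f(\mathbf{x})|_1}{|\mathbf{x}|}\, d\mathbf{x} \le C \int_{\mathbb{R}^3} |(\boldsymbol{\sigma}\cdot\mathbf{p}) f(\mathbf{x})|_1\, d\mathbf{x}$$ for all $f\in C_0^\infty(\mathbb{R}^3,\mathbb{C}^2)$.
   Context: $C_0^\infty(\mathbb{R}^3,\mathbb{C}^2)$ is the space of $\mathbb{C}^2$-valued functions on $\mathbb{R}^3$ whose components are smooth with compact support. The Pauli matrices are $\sigma_1=\begin{pmatrix}0&1\\1&0\end{pmatrix}$, $\sigma_2=\begin{pmatrix}0&-i\\i&0\end{pmatrix}$, $\sigma_3=\begin{pmatrix}1&0\\0&-1\end{pmatrix}$, and $\boldsymbol{\sigma}\cdot\mathbf{p} = -i\sum_{j=1}^3 \sigma_j \frac{\partial}{\partial x_j}$. For $\mathbf{a}=(a_1,a_2)\in\mathbb{C}^2$, $|\mathbf{a}|_1 = |a_1|+|a_2|$; $|\mathbf{x}|$ is the Euclidean norm of $\mathbf{x}\in\mathbb{R}^3$. *)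

(* Defs.v *)
From HB Require Import structures.
From mathcomp Require Import all_boot all_order all_algebra.
From mathcomp Require Import all_classical all_reals all_analysis.
From mathcomp Require Import complex.
Set Implicit Arguments.
Unset Strict Implicit.
Unset Printing Implicit Defensive.
Import Order.TTheory GRing.Theory Num.Theory.
Import numFieldNormedType.Exports.
Local Open Scope classical_set_scope.
Local Open Scope ring_scope.
Local Open Scope complex_scope.

(* The product type carries the sup norm, which is used below only for the
   topology and for derivatives; |x| is [enorm]. *)
Notation R3 R := (R * R * R)%type.

Definition enorm (R : realType) (x : R3 R) : R :=
  Num.sqrt (x.1.1 ^+ 2 + x.1.2 ^+ 2 + x.2 ^+ 2).

Definition lebesgue3 (R : realType) :
    {measure set (measurableTypeR R * measurableTypeR R * measurableTypeR R)
       -> \bar R} :=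
  ((@lebesgue_measure R \x @lebesgue_measure R) \x @lebesgue_measure R)%E.

Definition basis3 (R : realType) (j : 'I_3) : R3 R :=
  ((j == 0%N :> nat)%:R, (j == 1%N :> nat)%:R, (j == 2%N :> nat)%:R).

Definition partial (R : realType) (j : 'I_3) (g : R3 R -> R) : R3 R -> R :=
  fun x => 'D_(basis3 R j) g x.

Definition partials (R : realType) (s : seq 'I_3) (g : R3 R -> R) :
  R3 R -> R := foldr (@partial R) g s.

(* 'D_v is a junk value where the limit does not exist, hence the explicit
   derivability requirement. *)
Definition smooth (R : realType) (g : R3 R -> R) : Prop :=
  forall s : seq 'I_3, continuous (partials s g) /\
    forall (j : 'I_3) (x : R3 R), derivable (partials s g) x (basis3 R j).

Definition smoothC (R : realType) (g : R3 R -> R[i]) : Prop :=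
  smooth (fun x => complex.Re (g x)) /\ smooth (fun x => complex.Im (g x)).

Definition compact_support (R : realType) (g : R3 R -> R[i]) : Prop :=
  compact (closure [set x | g x != 0]).

(* C_0^oo(R^3, C^2), with elements of C^2 as column vectors *)
Definition C0oo (R : realType) (f : R3 R -> 'cV[R[i]]_2) : Prop :=
  forall k : 'I_2,
    smoothC (fun x => f x k 0) /\ compact_support (fun x => f x k 0).

(* The library has no real normed structure on R[i]: complex-valued functions
   are differentiated through their real and imaginary parts. *)
Definition partialC (R : realType) (j : 'I_3) (g : R3 R -> R[i]) :
    R3 R -> R[i] := fun x =>
  partial j (fun y => complex.Re (g y)) x +i*
  partial j (fun y => complex.Im (g y)) x.

Definition partialV (R : realType) (j : 'I_3) (f : R3 R -> 'cV[R[i]]_2) :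
  R3 R -> 'cV[R[i]]_2 := fun x => \col_k partialC j (fun y => f y k 0) x.

Definition mx22 (T : Type) (a b c d : T) : 'M[T]_2 :=
  \matrix_(k < 2, l < 2)
    if k == 0%N :> nat then (if l == 0%N :> nat then a else b)
    else (if l == 0%N :> nat then c else d).

(* [pauli j] is sigma_{j+1}: indices in 'I_3 start at 0. *)
Definition pauli (R : realType) (j : 'I_3) : 'M[R[i]]_2 :=
  match val j with
  | 0 => mx22 0 1 1 0
  | 1 => mx22 0 (- 'i%C) 'i%C 0
  | _ => mx22 1 0 0 (-1)
  end.

Definition sigma_p (R : realType) (f : R3 R -> 'cV[R[i]]_2) :
    R3 R -> 'cV[R[i]]_2 := fun x =>
  (- 'i%C) *: \sum_(j < 3) pauli R j *m partialV j f x.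

Definition norm1 (R : realType) (a : 'cV[R[i]]_2) : R :=
  \sum_(k < 2) ComplexField.Normc.normc (a k 0).

(* Main.v *)
From HB Require Import structures.
Require Import Defs.
From mathcomp Require Import all_boot all_order all_algebra.
From mathcomp Require Import all_classical all_reals all_analysis.
From mathcomp Require Import measurable_realfun complex ring lra.
Import Order.TTheory GRing.Theory Num.Theory.
Import numFieldNormedType.Exports.
Local Open Scope classical_set_scope.
Local Open Scope ring_scope.

(* For a radial profile h, the spinor f = h (sigma . x) e_1 satisfies
   |(sigma . p) f|_1 = |3 h + r h'| = r^-2 |(r^3 h)'|, while |f|_1 / r >= h.
   So the right-hand side only sees the variation of r^3 h, and the left-hand
   side dominates the integral of (r^3 h) / r^3, which diverges
   logarithmically as soon as r^3 h stays close to 1 over many scales.  We take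
   h = (w^3 + 3/2 w^5) chi with w = (1 + r^2)^-1/2 and a smooth cutoff chi at
   scale M: the right-hand side stays bounded as M grows, whereas each dyadic
   shell below M contributes a fixed amount to the left-hand side. *)

(** * The flat functions t^-n exp(-1/t), extended by 0 to t <= 0 *)

Section Flat.
Context {R : realType}.
Implicit Types (t : R) (m n : nat).

(** The powers of 1/t close the family under differentiation up to linear combinations, so one
    derivative formula yields smoothness to all orders. *)
Definition flat n t : R := if 0 < t then t^-1 ^+ n * expR (- t^-1) else 0.

Lemma flat_gt0E n t : 0 < t -> flat n t = t^-1 ^+ n * expR (- t^-1).
Proof. by rewrite /flat => ->. Qed.

Lemma flat_le0E n t : t <= 0 -> flat n t = 0.
Proof. by rewrite /flat leNgt => /negbTE ->. Qed.

Lemma flat_ge0 n t : 0 <= flat n t.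
Proof.
rewrite /flat; case: ifP => // t0.
by rewrite mulr_ge0 ?expR_ge0// exprn_ge0// invr_ge0 ltW.
Qed.

(** With y = 1/t, this is exp y >= y^(m+n) / (m+n)!. The case m = 2 gives the derivative at the
    origin, and m = 0 gives boundedness. *)
Lemma flat_le m n t : 0 <= t -> flat n t <= (m + n)`!%:R * t ^+ m.
Proof.
move=> t0; have [->|tn0] := eqVneq t 0.
  by rewrite flat_le0E// mulr_ge0// exprn_ge0.
have tp : 0 < t by rewrite lt_neqAle eq_sym tn0.
have yp : 0 < t^-1 by rewrite invr_gt0.
rewrite flat_gt0E// expRN ler_pdivrMr ?expR_gt0//.
have -> : t^-1 ^+ n = (m + n)`!%:R * t ^+ m * (t^-1 ^+ (m + n) / (m + n)`!%:R).
  have Fn0 : (m + n)`!%:R != 0 :> R by rewrite pnatr_eq0 -lt0n fact_gt0.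
  rewrite exprD !exprVn; move: (expf_neq0 m tn0) (expf_neq0 n tn0) => ? ?.
  by field; apply/and3P.
rewrite ler_pM2l; last by rewrite mulr_gt0 ?exprn_gt0// ltr0n fact_gt0.
(* [expR_ge1Dxn] only covers positive exponents; exponent 0 is exp y >= 1. *)
case: (m + n)%N => [|k].
  by rewrite fact0 expr0 divr1 -[1]expR0 ler_expR ltW.
by apply: le_trans (expR_ge1Dxn k (ltW yp)); rewrite lerDr.
Qed.

Lemma is_derive_flat n t :
  is_derive t 1 (flat n) (flat n.+2 t - n%:R * flat n.+1 t).
Proof.
have [t0|t0|->] := ltgtP t 0.
- rewrite !flat_le0E ?ltW// mulr0 subrr.
  apply: (@near_eq_is_derive _ _ _ (cst 0)).
  near=> y; rewrite flat_le0E//; near: y.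
  by apply: filterS (lt_nbhsl t0) => y; exact: ltW.
- rewrite !flat_gt0E//.
  suff H : is_derive t 1 (fun y : R => y^-1 ^+ n * expR (- y^-1))
      (t^-1 ^+ n.+2 * expR (- t^-1) - n%:R * (t^-1 ^+ n.+1 * expR (- t^-1))).
    apply: near_eq_is_derive H.
    near=> y; rewrite flat_gt0E//; near: y; exact: lt_nbhsr.
  have dV : is_derive t 1 (fun y : R => y^-1) (- t ^- 2).
    apply: is_derive_eq; first by apply: is_deriveV; rewrite gt_eqF.
    by rewrite [LHS]mulr1.
  have dE : is_derive t 1 (fun y : R => expR (- y^-1)) (t ^- 2 * expR (- t^-1)).
    have dNV : is_derive t 1 (fun y : R => - y^-1) (t ^- 2).
      by apply: is_derive_eq; rewrite opprK.
    apply: is_derive_eq (is_derive1_comp (is_derive_expR _) dNV) _.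
    by rewrite mulrC.
  have := is_deriveM (is_deriveX n dV) dE.
  rewrite mulrfctE !exprfctE /= => dM; apply: (is_derive_eq dM).
  rewrite /GRing.scale/=.
  case: n {dM} => [|n].
    by rewrite -!exprVn; ring.
  by rewrite -!exprVn /= !exprS; ring.
- rewrite !(flat_le0E _ _ (lexx 0)) mulr0 subrr.
  suff H : (fun h : R => h^-1 *: (flat n (h *: 1 + 0) - flat n 0)) @ 0^' --> (0 : R).
    by split; [apply/cvg_ex; exists 0|apply/cvg_lim].
  (* By [flat_le] with m = 2, the difference quotient at 0 is at most (n+2)! |h|. *)
  apply: (@cvg_to_0_linear _ _ (2 + n)`!%:R 1) => // h /andP[h0 _].
  rewrite (flat_le0E n 0)// subr0 addr0 [_ *: 1]mulr1 normrM normfV.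
  rewrite [X in _ * X]ger0_norm ?flat_ge0// mulrC ler_pdivrMr//.
  have [hp|hn] := ltP 0 h; last by rewrite flat_le0E// !mulr_ge0.
  by rewrite gtr0_norm// -mulrA -expr2; exact/flat_le/ltW.
Unshelve. all: by end_near. Qed.

End Flat.

(** * Chain rule and a criterion for smoothness *)

Lemma differentiable_derive_comp {R : realType} {V : normedModType R}
    {f : V -> R} {g : R -> R} {x : V} {dg : R} :
  differentiable f x -> is_derive (f x) 1 g dg ->
  differentiable (g \o f) x /\
  forall v, 'D_v (g \o f) x = dg * 'D_v f x.
Proof.
move=> df [dg1 dgE]; have dgf : differentiable g (f x) by exact/derivable1_diffP.
split=> [|v]; first exact: differentiable_comp.
rewrite deriveE; last exact: differentiable_comp.
rewrite diff_comp//= diff1E// derive1E dgE deriveE//.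
by rewrite [LHS]mulrC.
Qed.

(** Iterated partials never leave [S], so each is differentiable; no higher derivative has to be
    computed. *)
Lemma smooth_of_class (R : realType) (S : set (R3 R -> R)) :
  (forall g, S g -> forall x, differentiable g x) ->
  (forall g j, S g -> S (partial j g)) ->
  forall g, S g -> smooth g.
Proof.
move=> Sd Sp g Sg s.
have Sgs : S (partials s g) by elim: s => //= j s; exact: Sp.
split=> [x|j x]; first exact/differentiable_continuous/Sd.
exact/diff_derivable/Sd.
Qed.

(** * An algebra of smooth functions stable under differentiation *)

Section TestFunctions.
Context {R : realType}.
Implicit Types (x v : R3 R) (N : R).

Definition sqnorm x : R := x.1.1 ^+ 2 + x.1.2 ^+ 2 + x.2 ^+ 2.

Lemma sqnorm_ge0 x : 0 <= sqnorm x.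
Proof. by rewrite !addr_ge0// sqr_ge0. Qed.

Lemma oneDsqnorm_gt0 x : 0 < 1 + sqnorm x.
Proof. by rewrite ltr_wpDr// sqnorm_ge0. Qed.

(** The function w of the overview: it behaves like 1/|x| at infinity but is smooth at the
    origin. *)
Definition bracket x : R := (Num.sqrt (1 + sqnorm x))^-1.

(* [cut N 0] is the cutoff, supported in |x|^2 <= 1/N; the other indices only
   arise by differentiating it. *)
Definition cut N n x : R := flat n (1 - (N * sqnorm x) ^+ 2).

Definition linear_form v : R3 R -> R :=
  fun x => x.1.1 * v.1.1 + x.1.2 * v.1.2 + x.2 * v.2.

(** The generators are chosen so that the directional derivatives of each are polynomials in the
    generators; the Leibniz rule then gives stability for the whole algebra. *)
Inductive test_class N : set (R3 R -> R) :=
| test_cst c : test_class N (cst c)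
| test_linear v : test_class N (linear_form v)
| test_bracket : test_class N bracket
| test_cut n : test_class N (cut N n)
| test_add f g : test_class N f -> test_class N g -> test_class N (f \+ g)
| test_mul f g : test_class N f -> test_class N g -> test_class N (f \* g).

Fact linear_form_is_linear v : linear (linear_form v).
Proof.
move=> a [[x1 x2] x3] [[y1 y2] y3]; rewrite /linear_form /GRing.scale/=.
by rewrite /GRing.scale/=; ring.
Qed.

HB.instance Definition _ v := GRing.isLinear.Build R _ _ _ (linear_form v)
  (linear_form_is_linear v).

Lemma linear_form_continuous v : continuous (linear_form v).
Proof.
move=> x; apply: cvgD; [apply: cvgD|]; apply: cvgMl.
- by apply: (@cvg_comp _ _ _ fst fst); exact: cvg_fst.
- by apply: (@cvg_comp _ _ _ fst snd); [exact: cvg_fst|exact: cvg_snd].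
- exact: cvg_snd.
Qed.

Lemma linear_form_diff v x : differentiable (linear_form v) x /\
  forall w, 'D_w (linear_form v) x = linear_form v w.
Proof.
have df : differentiable (linear_form v) x.
  exact/linear_differentiable/linear_form_continuous.
by split=> // w; rewrite deriveE// diff_lin//; exact: linear_form_continuous.
Qed.

Lemma sqnorm_diff x : differentiable sqnorm x /\
  forall v, 'D_v sqnorm x = 2 * linear_form v x.
Proof.
have E : sqnorm = (linear_form (1, 0, 0)) ^+ 2 + (linear_form (0, 1, 0)) ^+ 2
   + (linear_form (0, 0, 1)) ^+ 2.
  apply/funext => y; rewrite /sqnorm/= !fctE /linear_form/=.
  by rewrite !(mulr0, mulr1, addr0, add0r).
have dl w := (linear_form_diff w x).1.
split=> [|v]; rewrite E.
  by do !apply: differentiableD; exact: differentiableX.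
have dX w : is_derive x v (linear_form w ^+ 2)
    ((2 * linear_form w x ^+ 1) *: linear_form w v).
  apply: is_deriveX.
  split; first exact: diff_derivable.
  exact: (linear_form_diff w x).2.
have [_ ->] := is_deriveD (is_deriveD (dX (1, 0, 0)) (dX (0, 1, 0))) (dX (0, 0, 1)).
by rewrite /linear_form /GRing.scale/=; ring.
Qed.

Lemma bracket_diff x : differentiable bracket x /\
  forall v, 'D_v bracket x = - (linear_form v x * bracket x ^+ 3).
Proof.
have [d e] := sqnorm_diff x.
have s0 : 0 < 1 + sqnorm x := oneDsqnorm_gt0 x.
have q0 : 0 < Num.sqrt (1 + sqnorm x) by rewrite sqrtr_gt0.
have H : is_derive (sqnorm x) 1 (fun t : R => (Num.sqrt (1 + t))^-1)
   (- (bracket x ^+ 3) / 2).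
  have H1 : is_derive (sqnorm x) 1 (fun t : R => 1 + t) 1.
    by apply: is_derive_eq; rewrite add0r mulr1.
  have H2 := is_derive1_comp (is_derive1_sqrt s0) H1.
  have q0' : (Num.sqrt \o (fun t : R => 1 + t)) (sqnorm x) != 0 by rewrite /= gt_eqF.
  apply: (is_derive_eq (is_deriveV q0' H2)).
  rewrite /GRing.scale/= /bracket; field.
  by rewrite gt_eqF.
have [d' e'] := differentiable_derive_comp d H.
split=> [|v]; first exact: d'.
by rewrite [LHS]e' e; field.
Qed.

(** The factor 4 N^2 collects -2 N^2 s from the derivative of 1 - (N s)^2 and 2 <v, x> from that of
    s = |x|^2. *)
Lemma cut_diff N n x : differentiable (cut N n) x /\
  forall v, 'D_v (cut N n) x =
    - (4 * N ^+ 2) *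
    (sqnorm x * linear_form v x * (cut N n.+2 x - n%:R * cut N n.+1 x)).
Proof.
have [d e] := sqnorm_diff x.
have H : is_derive (sqnorm x) 1 (fun t : R => 1 - (N * t) ^+ 2)
   (- (2 * N ^+ 2 * sqnorm x)).
  have H0 : is_derive (sqnorm x) 1 (fun t : R => N * t) N.
    by apply: is_derive_eq; rewrite [LHS]mulr1.
  apply: is_derive_eq; rewrite /GRing.scale/=; ring.
have H2 := is_derive1_comp (is_derive_flat n _) H.
have [d' e'] := differentiable_derive_comp d H2.
split=> [|v]; first exact: d'.
rewrite [LHS]e' e /cut; ring.
Qed.

Lemma test_class_diff N f : test_class N f -> forall x, differentiable f x.
Proof.
elim=> [c x|v x|x|n x|{}f g _ df _ dg x|{}f g _ df _ dg x].
- exact: differentiable_cst.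
- exact: (linear_form_diff v x).1.
- exact: (bracket_diff x).1.
- exact: (cut_diff N n x).1.
- exact: differentiableD.
- exact: differentiableM.
Qed.

Lemma test_sqnorm N : test_class N sqnorm.
Proof.
pose e1 := linear_form (1, 0, 0); pose e2 := linear_form (0, 1, 0).
pose e3 := linear_form (0, 0, 1).
have -> : sqnorm = (e1 \* e1 \+ e2 \* e2) \+ e3 \* e3.
  by apply/funext => y; rewrite /sqnorm /e1 /e2 /e3 /linear_form/=; ring.
by do !apply: test_add; apply: test_mul; exact: test_linear.
Qed.

Lemma test_class_derive N f v : test_class N f -> test_class N (fun x => 'D_v f x).
Proof.
elim=> [c|w||n|{}f g tf df tg dg|{}f g tf df tg dg].
- rewrite (_ : (fun _ => _) = cst 0); first exact: test_cst.
  by apply/funext => x; rewrite derive_cst.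
- rewrite (_ : (fun _ => _) = cst (linear_form w v)); first exact: test_cst.
  by apply/funext => x; rewrite (linear_form_diff w x).2.
- rewrite (_ : (fun _ => _) =
      cst (-1) \* (linear_form v \* (bracket \* (bracket \* bracket)))).
    by do ?[apply: test_mul|exact: test_cst|exact: test_linear|exact: test_bracket].
  by apply/funext => x; rewrite (bracket_diff x).2/=; ring.
- rewrite (_ : (fun _ => _) = cst (- (4 * N ^+ 2)) \* ((sqnorm \* linear_form v) \*
     (cut N n.+2 \+ cst (- n%:R) \* cut N n.+1))).
    apply: test_mul; first exact: test_cst.
    apply: test_mul; first by apply: test_mul; [exact: test_sqnorm|exact: test_linear].
    apply: test_add; first exact: test_cut.
    by apply: test_mul; [exact: test_cst|exact: test_cut].
  by apply/funext => x; rewrite (cut_diff N n x).2/=; ring.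
- rewrite (_ : (fun _ => _) = (fun x => 'D_v f x) \+ (fun x => 'D_v g x)).
    exact: test_add.
  by apply/funext => x; rewrite deriveD//; apply/diff_derivable/(test_class_diff N).
- rewrite (_ : (fun _ => _) = (f \* (fun x => 'D_v g x)) \+ (g \* (fun x => 'D_v f x))).
    by apply: test_add; exact: test_mul.
  by apply/funext => x; rewrite deriveM//; apply/diff_derivable/(test_class_diff N).
Qed.

Lemma test_class_smooth N f : test_class N f -> smooth f.
Proof.
apply: smooth_of_class => [g|g j]; first exact: test_class_diff.
exact: test_class_derive.
Qed.

End TestFunctions.

(** * The spinor h (sigma . x) e_1 and its image under sigma . p *)

Section Spinor.
Context {R : realType}.
Implicit Types (x v : R3 R) (h H : R3 R -> R) (a : R).
Local Open Scope complex_scope.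

(** This is [h x] times the first column of the matrix sigma . x. *)
Definition hedgehog h x : 'cV[R[i]]_2 :=
  \col_k if k == 0 then (h x * x.2) +i* 0 else (h x * x.1.1) +i* (h x * x.1.2).

Lemma norm1E (z w : R[i]) (u : 'cV[R[i]]_2) : u 0 0 = z -> u 1 0 = w ->
  norm1 u = ComplexField.Normc.normc z + ComplexField.Normc.normc w.
Proof.
move=> <- <-; rewrite /norm1 !big_ord_recl big_ord0 addr0; congr (_ + _).
by congr (ComplexField.Normc.normc (u _ 0)); apply/val_inj.
Qed.

(** For radial [h], the function [H] is h'(r) / r: the gradient of [h] is [H x] times the vector x,
    with no division by r at the origin. *)
Lemma partial_hedgehog h H v (j : 'I_3) x :
  differentiable h x ->
  (forall v, 'D_v h x = linear_form v x * H x) ->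
  partial j (h \* linear_form v) x =
  h x * linear_form v (basis3 R j) + linear_form v x * linear_form (basis3 R j) x * H x.
Proof.
move=> dh hE; have [dl lE] := linear_form_diff v x.
rewrite /partial deriveM; [|exact: diff_derivable|exact: diff_derivable].
by rewrite lE hE /GRing.scale/= mulrA.
Qed.

Lemma hedgehog_Re0 h :
  (fun x => complex.Re (hedgehog h x 0 0)) = h \* linear_form (0, 0, 1).
Proof.
by apply/funext => x; rewrite mxE/= /linear_form/= !mulr0 !add0r mulr1.
Qed.

Lemma hedgehog_Im0 h : (fun x => complex.Im (hedgehog h x 0 0)) = cst 0.
Proof. by apply/funext => x; rewrite mxE. Qed.

Lemma hedgehog_Re1 h :
  (fun x => complex.Re (hedgehog h x 1 0)) = h \* linear_form (1, 0, 0).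
Proof.
by apply/funext => x; rewrite mxE/= /linear_form/= !mulr0 !addr0 mulr1.
Qed.

Lemma hedgehog_Im1 h :
  (fun x => complex.Im (hedgehog h x 1 0)) = h \* linear_form (0, 1, 0).
Proof.
by apply/funext => x; rewrite mxE/= /linear_form/= !mulr0 add0r addr0 mulr1.
Qed.

Let j1 := @Ordinal 3 0 isT.
Let j2 := @Ordinal 3 1 isT.
Let j3 := @Ordinal 3 2 isT.

Lemma big_ord3 (V : nmodType) (G : 'I_3 -> V) :
  \sum_(j < 3) G j = G j1 + G j2 + G j3.
Proof.
rewrite !big_ord_recl big_ord0 addr0 addrA.
by congr (G _ + G _ + G _); exact: val_inj.
Qed.

Lemma pauli1E : [/\ pauli R j1 0 0 = 0, pauli R j1 0 1 = 1,
  pauli R j1 1 0 = 1 & pauli R j1 1 1 = 0].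
Proof. by rewrite /pauli/= !mxE. Qed.

Lemma pauli2E : [/\ pauli R j2 0 0 = 0, pauli R j2 0 1 = - 'i%C,
  pauli R j2 1 0 = 'i%C & pauli R j2 1 1 = 0].
Proof. by rewrite /pauli/= !mxE. Qed.

Lemma pauli3E : [/\ pauli R j3 0 0 = 1, pauli R j3 0 1 = 0,
  pauli R j3 1 0 = 0 & pauli R j3 1 1 = -1].
Proof. by rewrite /pauli/= !mxE. Qed.

(** For a vector field F, (sigma . p)(sigma . F) = -i (div F + i sigma . curl F). Here F = h x has
    zero curl, its gradient matrix being symmetric, and divergence 3 h + |x|^2 H. Hence the second
    component vanishes and the first is purely imaginary. *)
Lemma sigma_p_hedgehog h H x :
  differentiable h x ->
  (forall v, 'D_v h x = linear_form v x * H x) ->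
  norm1 (sigma_p (hedgehog h) x) = `|3 * h x + sqnorm x * H x|.
Proof.
move=> dh hE.
pose d v j := h x * linear_form v (basis3 R j) +
  linear_form v x * linear_form (basis3 R j) x * H x.
have p0 j : partialV j (hedgehog h) x 0 0 = d (0, 0, 1) j +i* 0.
  rewrite mxE /partialC hedgehog_Re0 hedgehog_Im0 (partial_hedgehog _ H)//.
  by rewrite /partial derive_cst.
have p1 j : partialV j (hedgehog h) x 1 0 = d (1, 0, 0) j +i* d (0, 1, 0) j.
  by rewrite mxE /partialC hedgehog_Re1 hedgehog_Im1 !(partial_hedgehog _ H).
have sE k : sigma_p (hedgehog h) x k 0 = - 'i%C * \sum_(j < 3)
    (pauli R j k 0 * (d (0, 0, 1) j +i* 0) +
     pauli R j k 1 * (d (1, 0, 0) j +i* d (0, 1, 0) j)).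
  rewrite mxE summxE; congr (_ * _); apply: eq_bigr => j _.
  rewrite mxE !big_ord_recl big_ord0 addr0 -p0 -p1; congr (_ + _ * _).
    by congr (pauli R j k _); apply/val_inj.
  by congr (partialV j _ x _ 0); apply/val_inj.
move: pauli1E pauli2E pauli3E (sE 0) (sE 1); rewrite !big_ord3.
move: (pauli R j1) (pauli R j2) (pauli R j3) => P1 P2 P3.
move=> [a00 a01 a10 a11] [b00 b01 b10 b11] [c00 c01 c10 c11].
rewrite a00 a01 a10 a11 b00 b01 b10 b11 c00 c01 c10 c11 => s0 s1.
rewrite (norm1E (0 -i* (3 * h x + sqnorm x * H x)) 0).
- rewrite /ComplexField.Normc.normc/= !expr0n/= !add0r sqrtr0 addr0.
  by rewrite sqrrN sqrtr_sqr.
- rewrite s0 /d /basis3 /linear_form /sqnorm /=.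
  case: x {dh hE p0 p1 sE d s0 s1} => [[x1 x2] x3] /=; move: (h _) (H _) => u w.
  by apply/eqP; rewrite eq_complex/=; apply/andP; split; apply/eqP; ring.
- rewrite s1 /d /basis3 /linear_form /sqnorm /=.
  case: x {dh hE p0 p1 sE d s0 s1} => [[x1 x2] x3] /=; move: (h _) (H _) => u w.
  by apply/eqP; rewrite eq_complex/=; apply/andP; split; apply/eqP; ring.
Qed.

End Spinor.

(** * The radial profile: pointwise bounds and membership in the test space *)

Section Profile.
Context {R : realType}.
Implicit Types (x v : R3 R) (a M : R).

Lemma bracket_gt0 x : 0 < bracket x.
Proof. by rewrite invr_gt0 sqrtr_gt0 oneDsqnorm_gt0. Qed.

Lemma bracket_sqr x : bracket x ^+ 2 = (1 + sqnorm x)^-1.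
Proof. by rewrite exprVn sqr_sqrtr// ltW// oneDsqnorm_gt0. Qed.

(** This relation trades |x|^2 for powers of w and drives the cancellation in [profile_flux]. *)
Lemma bracket_sqrM x : bracket x ^+ 2 * sqnorm x = 1 - bracket x ^+ 2.
Proof. by rewrite bracket_sqr; field; rewrite gt_eqF// oneDsqnorm_gt0. Qed.

Lemma bracket_le1 x : bracket x <= 1.
Proof.
rewrite -(@expr_le1 _ 2)//; last exact/ltW/bracket_gt0.
by rewrite -subr_ge0 -bracket_sqrM mulr_ge0 ?sqr_ge0 ?sqnorm_ge0.
Qed.

Definition profile a x : R :=
  (bracket x ^+ 3 + 3 / 2 * bracket x ^+ 5) * cut a 0 x.

(** The [H] of [sigma_p_hedgehog] for [profile a]: w^k has gradient -k w^(k+2) x, whence 3 and 15/2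
    = 5 (3/2), and the last term comes from the cutoff. *)
Definition profile_slope a x : R :=
  - (3 * bracket x ^+ 5 + 15 / 2 * bracket x ^+ 7) * cut a 0 x -
  4 * a ^+ 2 * sqnorm x * (bracket x ^+ 3 + 3 / 2 * bracket x ^+ 5) * cut a 2 x.

Lemma profile_test a : test_class a (profile a).
Proof.
rewrite (_ : profile a =
  (bracket \* (bracket \* bracket) \* (cst 1 \+ cst (3 / 2) \* (bracket \* bracket)))
  \* cut a 0); last by apply/funext => x; rewrite /profile/=; ring.
apply: test_mul; last exact: test_cut.
by do ?[apply: test_mul|apply: test_add|exact: test_cst|exact: test_bracket].
Qed.

Lemma profile_derive a v x :
  'D_v (profile a) x = linear_form v x * profile_slope a x.
Proof.
have [bd bE] := bracket_diff x; have [cd cE] := cut_diff a 0 x.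
have Db : is_derive x v bracket (- (linear_form v x * bracket x ^+ 3)).
  by split; [exact: diff_derivable|exact: bE].
have Dc : is_derive x v (cut a 0) _ := DeriveDef (diff_derivable cd) (cE v).
have D3 := is_deriveX 3 Db; have D5 := is_deriveX 5 Db.
have := is_deriveM (is_deriveD D3 (is_deriveZ (3 / 2) D5)) Dc.
have -> : (bracket ^+ 3 + (3 / 2) *: bracket ^+ 5) * cut a 0 = profile a.
  by apply/funext => y; rewrite /profile mulrfctE !fctE.
by case=> _ ->; rewrite /profile_slope !fctE/= /GRing.scale/=; field.
Qed.

Lemma profile_ge0 a x : 0 <= profile a x.
Proof.
have b0 := ltW (bracket_gt0 x).
by rewrite mulr_ge0 ?flat_ge0// addr_ge0 ?mulr_ge0 ?exprn_ge0// divr_ge0.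
Qed.

Lemma profile_ge a x : 0 <= a -> a * sqnorm x <= 2^-1 ->
  expR (-2) * bracket x ^+ 3 <= profile a x.
Proof.
move=> a0 ax; have as0 : 0 <= a * sqnorm x by rewrite mulr_ge0 ?sqnorm_ge0.
have b0 := ltW (bracket_gt0 x).
(* The argument of [flat] is at least 1/2, so the cutoff is at least exp(-2); the w^5 term is
   dropped. *)
have t0 : 2^-1 <= 1 - (a * sqnorm x) ^+ 2 by nra.
rewrite /profile mulrC ler_pM ?exprn_ge0 ?expR_ge0//.
  by rewrite lerDl mulr_ge0 ?exprn_ge0 ?divr_ge0.
have t1 : 0 < 1 - (a * sqnorm x) ^+ 2 by rewrite (lt_le_trans _ t0).
by rewrite /cut flat_gt0E// expr0 mul1r ler_expR lerN2 -[leRHS]invrK lef_pV2 ?posrE.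
Qed.

Lemma profile_eq0 a x : 1 <= a * sqnorm x -> profile a x = 0.
Proof.
by move=> ax; rewrite /profile /cut flat_le0E ?mulr0// subr_le0 exprn_ege1.
Qed.

(* [3 h + |x|^2 H] is |x|^-2 times the radial derivative of |x|^3 h; the
   coefficient 3/2 in [profile] is the one that makes the [bracket ^+ 5] terms
   cancel, leaving an integrable remainder. *)
Lemma profile_flux a x : 3 * profile a x + sqnorm x * profile_slope a x =
  15 / 2 * bracket x ^+ 7 * cut a 0 x -
  4 * a ^+ 2 * sqnorm x ^+ 2 * (bracket x ^+ 3 + 3 / 2 * bracket x ^+ 5) * cut a 2 x.
Proof.
have E := bracket_sqrM x.
have E5 : sqnorm x * bracket x ^+ 5 = bracket x ^+ 3 - bracket x ^+ 5.
  transitivity (bracket x ^+ 3 * (bracket x ^+ 2 * sqnorm x)); first by ring.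
  by rewrite E; ring.
have E7 : sqnorm x * bracket x ^+ 7 = bracket x ^+ 5 - bracket x ^+ 7.
  transitivity (bracket x ^+ 5 * (bracket x ^+ 2 * sqnorm x)); first by ring.
  by rewrite E; ring.
rewrite /profile /profile_slope; move: E5 E7.
set b3 := bracket x ^+ 3; set b5 := bracket x ^+ 5; set b7 := bracket x ^+ 7.
move=> E5 E7.
transitivity
  ((3 * b3 + 9 / 2 * b5 - 3 * (sqnorm x * b5) - 15 / 2 * (sqnorm x * b7)) * cut a 0 x
   - 4 * a ^+ 2 * sqnorm x ^+ 2 * (b3 + 3 / 2 * b5) * cut a 2 x).
  by ring.
(* The coefficient of w^5 becomes 9/2 + 3 - 15/2 = 0, and that of w^3 becomes 3 - 3 = 0. *)
by rewrite E5 E7; field.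
Qed.

Lemma sqr_le_sqnorm x :
  [/\ x.1.1 ^+ 2 <= sqnorm x, x.1.2 ^+ 2 <= sqnorm x & x.2 ^+ 2 <= sqnorm x].
Proof.
rewrite /sqnorm; have := sqr_ge0 x.1.1; have := sqr_ge0 x.1.2; have := sqr_ge0 x.2.
by split; lra.
Qed.

(** One power of w is dropped and w^6 = (1 + |x|^2)^-3 is split, one factor per coordinate. The
    bound is a tensor product, so it integrates by Tonelli without polar coordinates. *)
Lemma bracket7_le x : bracket x ^+ 7 <=
  (oneDsqr x.1.1)^-1 * (oneDsqr x.1.2)^-1 * (oneDsqr x.2)^-1.
Proof.
have b0 := bracket_gt0 x; have [h1 h2 h3] := sqr_le_sqnorm x.
apply: (@le_trans _ _ (bracket x ^+ 6)).
  by rewrite exprS ler_piMl ?bracket_le1// exprn_ge0// ltW.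
rewrite (exprM _ 2 3) bracket_sqr !exprS expr0 mulr1 mulrA.
have p t : 0 < oneDsqr t :> R by rewrite (lt_le_trans _ (oneDsqr_ge1 t)).
have l t : t ^+ 2 <= sqnorm x -> (1 + sqnorm x)^-1 <= (oneDsqr t)^-1.
  by move=> ht; rewrite lef_pV2 ?posrE ?oneDsqnorm_gt0// lerD2l.
have z : 0 <= (1 + sqnorm x)^-1 by rewrite invr_ge0 ltW// oneDsqnorm_gt0.
by rewrite !ler_pM ?mulr_ge0 ?l.
Qed.

Definition cube M : set (R3 R) := (`[- M, M] `*` `[- M, M]) `*` `[- M, M].

Lemma in_cube M x : 0 <= M -> sqnorm x <= M ^+ 2 -> cube M x.
Proof.
move=> M0 sM; have [h1 h2 h3] := sqr_le_sqnorm x.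
have H t : t ^+ 2 <= sqnorm x -> `[- M, M]%classic t.
  move=> ht; rewrite /= in_itv/= -ler_norml -(@ler_pXn2r _ 2)// ?nnegrE//.
  by rewrite real_normK ?num_real// (le_trans ht).
by split; [split|]; exact: H.
Qed.

(** The left side is (w^2 |x|^2)^2 / w <= 1 / w = (1 + |x|^2)^(1/2). The factor |x|^4 is due to the
    square inside [cut]; it makes the cutoff error O(M^-3) uniformly, small near the origin too. *)
Lemma bracket3_sqnorm_le M x : 1 <= M -> sqnorm x <= M ^+ 2 ->
  bracket x ^+ 3 * sqnorm x ^+ 2 <= 2 * M.
Proof.
move=> M1 sM; have b0 := bracket_gt0 x; have s0 := sqnorm_ge0 x.
have -> : bracket x ^+ 3 * sqnorm x ^+ 2 =
    (bracket x ^+ 2 * sqnorm x) ^+ 2 / bracket x.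
  by field; rewrite gt_eqF.
have q1 : bracket x ^+ 2 * sqnorm x <= 1 by rewrite bracket_sqrM gerBl sqr_ge0.
have q0 : 0 <= bracket x ^+ 2 * sqnorm x by rewrite mulr_ge0 ?sqr_ge0.
apply: (@le_trans _ _ (bracket x)^-1).
  by rewrite ler_piMl ?invr_ge0 ?(ltW b0)// expr_le1.
rewrite -(@ler_pXn2r _ 2)// ?nnegrE ?invr_ge0 ?(ltW b0)//; last lra.
by rewrite exprVn bracket_sqr invrK; nra.
Qed.

(** The first term is integrable independently of M; the second, caused by the cutoff, has size M^-3
    on a set of volume of order M^3. *)
Lemma profile_flux_le M x : 1 <= M ->
  `|3 * profile (M ^- 2) x + sqnorm x * profile_slope (M ^- 2) x| <=
  15 / 2 * ((oneDsqr x.1.1)^-1 * (oneDsqr x.1.2)^-1 * (oneDsqr x.2)^-1) +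
  40 * M ^- 3 * \1_(cube M) x.
Proof.
move=> M1; have M0 : 0 < M by rewrite (lt_le_trans _ M1).
rewrite profile_flux; set a := M ^- 2.
have b0 := bracket_gt0 x; have b1 := bracket_le1 x; have s0 := sqnorm_ge0 x.
apply: le_trans (ler_normB _ _) _; apply: lerD.
  rewrite ger0_norm; last by rewrite !mulr_ge0 ?flat_ge0 ?exprn_ge0 ?invr_ge0// ltW.
  rewrite -mulrA ler_pM2l ?divr_gt0//; apply: le_trans (bracket7_le x).
  rewrite ler_piMr//; first by rewrite exprn_ge0// ltW.
  rewrite /cut /flat; case: ifPn => // t0.
  by rewrite expr0 mul1r -[leRHS]expR0 ler_expR oppr_le0 invr_ge0 ltW.
have [as1|as1] := leP 1 (a * sqnorm x).
  rewrite (_ : cut a 2 x = 0); last first.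
    by rewrite /cut flat_le0E// subr_le0 exprn_ege1.
  by rewrite mulr0 normr0 !mulr_ge0// invr_ge0 exprn_ge0// ltW.
have sM : sqnorm x <= M ^+ 2.
  by move: as1; rewrite /a mulrC ltr_pdivrMr ?exprn_gt0// mul1r => /ltW.
rewrite indicE mem_set ?mulr1; last by apply: in_cube => //; exact: ltW.
(* The bound 2 is the factorial (0 + 2)! of [flat_le]. *)
have c2 : cut a 2 x <= 2.
  rewrite /cut; have [t0|t0] := leP 0 (1 - (a * sqnorm x) ^+ 2).
    by apply: le_trans (flat_le 0 2 _ t0) _; rewrite expr0 mulr1.
  by rewrite flat_le0E// ltW.
have c20 : 0 <= cut a 2 x := flat_ge0 _ _.
have b30 : 0 <= bracket x ^+ 3 by rewrite exprn_ge0// ltW.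
have b53 : bracket x ^+ 3 + 3 / 2 * bracket x ^+ 5 <= 5 / 2 * bracket x ^+ 3.
  have -> : bracket x ^+ 5 = bracket x ^+ 3 * bracket x ^+ 2 by ring.
  have b2 : bracket x ^+ 2 <= 1 by rewrite expr_le1// ltW.
  by nra.
have b50 : 0 <= bracket x ^+ 3 + 3 / 2 * bracket x ^+ 5.
  by rewrite addr_ge0// mulr_ge0 ?divr_ge0// exprn_ge0// ltW.
have a2 : 0 <= 4 * a ^+ 2 by apply: mulr_ge0 => //; exact: sqr_ge0.
have as2 : 0 <= 4 * a ^+ 2 * sqnorm x ^+ 2 by apply: mulr_ge0; rewrite ?sqr_ge0.
rewrite ger0_norm; last by apply: mulr_ge0 => //; exact: mulr_ge0.
apply: (@le_trans _ _ (4 * a ^+ 2 * sqnorm x ^+ 2 * (5 / 2 * bracket x ^+ 3) * 2)).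
  by apply: ler_pM => //; [exact: mulr_ge0|exact: ler_wpM2l].
have -> : 4 * a ^+ 2 * sqnorm x ^+ 2 * (5 / 2 * bracket x ^+ 3) * 2 =
    20 * a ^+ 2 * (bracket x ^+ 3 * sqnorm x ^+ 2) by field.
(* Since a = M^-2, this is 40 M^-3. *)
apply: (@le_trans _ _ (20 * a ^+ 2 * (2 * M))).
  by rewrite ler_wpM2l ?bracket3_sqnorm_le// mulr_ge0 ?sqr_ge0.
rewrite le_eqVlt; apply/orP; left; apply/eqP; rewrite /a.
by field; rewrite gt_eqF.
Qed.

Lemma compact_support_sqnorm (g : R3 R -> R[i]) M :
  (forall x, M ^+ 2 <= sqnorm x -> g x = 0) -> 0 <= M -> compact_support g.
Proof.
move=> g0 M0; have cK : compact (cube M).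
  by apply: compact_setX; [apply: compact_setX|]; exact: segment_compact.
have clK : closed (cube M) by apply: compact_closed => //; exact: norm_hausdorff.
apply: (subclosed_compact _ cK); first exact: closed_closure.
rewrite closureE => x; apply; split=> // y/= gy.
apply: in_cube => //; rewrite leNgt; apply: contra gy => /ltW My.
by rewrite g0.
Qed.

Lemma hedgehog_profile_C0oo M : 1 <= M -> C0oo (hedgehog (profile (M ^- 2))).
Proof.
move=> M1; have M0 : 0 < M by rewrite (lt_le_trans _ M1).
have E0 x : M ^+ 2 <= sqnorm x -> profile (M ^- 2) x = 0.
  move=> sM; apply: profile_eq0.
  by rewrite mulrC ler_pdivlMr ?mul1r// exprn_gt0.
have tl v : smooth (profile (M ^- 2) \* linear_form v).
  apply: (@test_class_smooth _ (M ^- 2)).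
  by apply: test_mul; [exact: profile_test|exact: test_linear].
move=> k; split; last first.
  apply: (@compact_support_sqnorm _ M) => [x sM|]; last exact: ltW.
  by rewrite mxE E0// !mul0r; case: ifP.
have [->|->] : k = 0 \/ k = 1.
  by case: k => -[|[|//]] ?; [left|right]; exact: val_inj.
- split; first by rewrite hedgehog_Re0.
  rewrite hedgehog_Im0; apply: (@test_class_smooth _ (M ^- 2)); exact: test_cst.
- by split; rewrite ?hedgehog_Re1 ?hedgehog_Im1.
Qed.

(** The 1-norm is h (|x_3| + (x_1^2 + x_2^2)^(1/2)), and a sum of two nonnegative numbers dominates
    the root of the sum of their squares. *)
Lemma norm1_hedgehog_ge h x : 0 <= h x -> h x * enorm x <= norm1 (hedgehog h x).
Proof.
move=> h0; rewrite (@norm1E _ ((h x * x.2) +i* 0) ((h x * x.1.1) +i* (h x * x.1.2)))%C.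
- rewrite /ComplexField.Normc.normc expr0n/= addr0 sqrtr_sqr normrM ger0_norm//.
  have -> : (h x * x.1.1) ^+ 2 + (h x * x.1.2) ^+ 2 =
      h x ^+ 2 * (x.1.1 ^+ 2 + x.1.2 ^+ 2).
    by ring.
  rewrite sqrtrM ?sqr_ge0// sqrtr_sqr (ger0_norm h0) -mulrDr ler_wpM2l//.
  have r0 : 0 <= x.1.1 ^+ 2 + x.1.2 ^+ 2 by rewrite addr_ge0 ?sqr_ge0.
  have q0 := sqrtr_ge0 (x.1.1 ^+ 2 + x.1.2 ^+ 2).
  rewrite -(@ler_pXn2r _ 2)// ?nnegrE ?addr_ge0 ?sqrtr_ge0//.
  rewrite /enorm sqr_sqrtr ?addr_ge0 ?sqr_ge0// sqrrD sqr_sqrtr// real_normK ?num_real//.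
  have := mulr_ge0 (normr_ge0 x.2) q0; lra.
- by rewrite mxE.
- by rewrite mxE.
Qed.

End Profile.

(* Unlike the library's [ge0_le_integral], no measurability is required. *)
Lemma ge0_le_integral_nonmeasurable d (T : measurableType d) (R : realType)
    (mu : {measure set T -> \bar R}) (f g : T -> \bar R) :
  (forall x, 0 <= f x)%E -> (forall x, f x <= g x)%E ->
  (\int[mu]_x f x <= \int[mu]_x g x)%E.
Proof.
move=> f0 fg; have g0 x : (0 <= g x)%E by rewrite (le_trans (f0 x)).
rewrite !ge0_integralTE//; apply: le_ereal_sup => _ [h hf <-].
by exists h => // x; rewrite (le_trans (hf x)).
Qed.

Lemma integral_tensor d1 d2 (T1 : measurableType d1) (T2 : measurableType d2)
    (R : realType) (m1 : {sigma_finite_measure set T1 -> \bar R})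
    (m2 : {sigma_finite_measure set T2 -> \bar R}) (f : T1 -> R) (g : T2 -> R) :
  measurable_fun setT f -> measurable_fun setT g ->
  (forall x, 0 <= f x) -> (forall y, 0 <= g y) ->
  (\int[m1 \x m2]_z (f z.1 * g z.2)%:E =
   \int[m1]_x (f x)%:E * \int[m2]_y (g y)%:E)%E.
Proof.
move=> mf mg f0 g0.
have mfg : measurable_fun setT (fun z : T1 * T2 => f z.1 * g z.2).
  by apply: measurable_funM; apply: measurableT_comp.
rewrite fubini_tonelli1/=; last 2 first.
- exact/measurable_EFinP.
- by move=> z; rewrite lee_fin mulr_ge0.
rewrite /fubini_F/= -ge0_integralZr//; last 3 first.
- exact/measurable_EFinP.
- by move=> x _; rewrite lee_fin.
- by apply: integral_ge0 => y _; rewrite lee_fin.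
apply: eq_integral => x _; under eq_integral do rewrite EFinM.
rewrite ge0_integralZl//.
- exact/measurable_EFinP.
- by move=> y _; rewrite lee_fin.
- by rewrite lee_fin.
Qed.

Lemma norm1_ge0 (R : realType) (u : 'cV[R[i]]_2) : 0 <= norm1 u.
Proof. by apply: sumr_ge0 => k _; case: (u k 0) => ? ?; exact: sqrtr_ge0. Qed.

(** * Integral bounds: the right-hand side stays bounded, the left-hand side grows *)

Section Integrals.
Context {R : realType}.
Local Notation mu := (@lebesgue_measure R).

(* The library's sigma-finite instance for [\x] is only found for pairs of
   subprobabilities. *)
Definition lebesgue2 :
  set (measurableTypeR R * measurableTypeR R)%type -> \bar R := (mu \x mu)%E.

HB.instance Definition _ := Measure.on lebesgue2.

Lemma lebesgue2_sigma_finite : sigma_finite setT lebesgue2.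
Proof.
exists (fun n => `[- n%:R, n%:R] `*` `[- n%:R, n%:R]).
  apply/seteqP; split=> // -[x y] _.
  exists (Num.truncn (Num.max `|x| `|y|)).+1 => //=.
  have := truncnS_gt (Num.max `|x| `|y|); rewrite gt_max => /andP[/ltW hx /ltW hy].
  by rewrite !in_itv/= -!ler_norml hx hy.
move=> n; split; first exact: measurableX.
have [r rE] : exists r, mu `[- n%:R, n%:R] = r%:E.
  rewrite lebesgue_measure_itv/=; case: ifP => _; last by exists 0.
  by rewrite -EFinB; eexists.
set I := [set` _] in rE *.
have -> : lebesgue2 (I `*` I) = (mu I * mu I)%E.
  by apply: product_measure1E; exact: measurable_itv.
by rewrite rE -EFinM ltry.
Qed.

HB.instance Definition _ := Measure_isSigmaFinite.Build _ _ _ lebesgue2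
  lebesgue2_sigma_finite.

Lemma measurable_oneDsqrV : measurable_fun setT (fun t : R => (oneDsqr t)^-1).
Proof. by apply: continuous_measurable_fun; exact: continuous_oneDsqrV. Qed.

Lemma integral_oneDsqrV : (\int[mu]_t ((oneDsqr t)^-1)%:E = pi%:E)%E.
Proof.
rewrite ge0_symfun_integralT/=.
- rewrite (_ : [set x | 0 <= x] = `[0, +oo[%classic); last first.
    by apply/seteqP; split=> x /=; rewrite in_itv/= andbT.
  by rewrite integral0y_oneDsqr -EFinM; congr (_%:E); field.
- by move=> t; rewrite invr_ge0 (le_trans _ (oneDsqr_ge1 t)).
- exact: continuous_oneDsqrV.
- by move=> t; rewrite /= /oneDsqr sqrrN.
Qed.

Lemma lebesgue3_box (A B C : set (measurableTypeR R)) :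
  measurable A -> measurable B -> measurable C ->
  (lebesgue3 R (A `*` B `*` C) = mu A * mu B * mu C)%E.
Proof.
move=> mA mB mC; transitivity ((mu \x mu)%E (A `*` B) * mu C)%E.
  by apply: product_measure1E => //; exact: measurableX.
by congr (_ * _)%E; exact: product_measure1E.
Qed.

Lemma lebesgue3_cube (M : R) : 0 < M ->
  lebesgue3 R (cube M) = (8 * M ^+ 3)%:E.
Proof.
move=> M0; rewrite /cube lebesgue3_box//.
rewrite lebesgue_measure_itv/= lte_fin ifT; last by rewrite gtrN.
by rewrite -EFinB -!EFinM; congr (_%:E); ring.
Qed.

Lemma measurable_cube (M : R) :
  measurable (cube M : set (measurableTypeR R * measurableTypeR R * measurableTypeR R)).
Proof. by apply: measurableX => //; exact: measurableX. Qed.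

(** Three integrals of 1 / (1 + t^2) give pi^3, and 320 = 40 M^-3 times the volume 8 M^3 of the
    cube. *)
Lemma integral_flux_le (M : R) : 1 <= M ->
  (\int[lebesgue3 R]_x (norm1 (sigma_p (hedgehog (profile (M ^- 2))) x))%:E
   <= (15 / 2 * pi ^+ 3 + 320)%:E)%E.
Proof.
move=> M1; have M0 : 0 < M by rewrite (lt_le_trans _ M1).
pose p (t : measurableTypeR R) : R := (oneDsqr t)^-1.
pose g (z : measurableTypeR R * measurableTypeR R) : R := p z.1 * p z.2.
pose T := (measurableTypeR R * measurableTypeR R * measurableTypeR R)%type.
have p0 t : 0 <= p t by rewrite invr_ge0 (le_trans _ (oneDsqr_ge1 t)).
have mp : measurable_fun setT p by exact: measurable_oneDsqrV.
have mg : measurable_fun setT g.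
  by apply: measurable_funM; apply: measurableT_comp.
have g0 z : 0 <= g z by rewrite mulr_ge0.
have mgp : measurable_fun setT (fun x : T => g x.1 * p x.2).
  by apply: measurable_funM; apply: measurableT_comp.
have M30 : 0 <= 40 * M ^- 3 by rewrite mulr_ge0// invr_ge0 exprn_ge0// ltW.
have mc : measurable_fun setT (\1_(cube M : set T) : T -> R).
  by apply: measurable_indic; exact: measurable_cube.
apply: (@le_trans _ _ (\int[lebesgue3 R]_(x in [set: T])
    ((15 / 2)%:E * (g x.1 * p x.2)%:E + (40 * M ^- 3)%:E * (\1_(cube M) x)%:E))%E).
  apply: ge0_le_integral_nonmeasurable => x.
    by rewrite lee_fin norm1_ge0.
  rewrite -!EFinM -EFinD lee_fin (@sigma_p_hedgehog _ _ (profile_slope (M ^- 2))).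
  - exact: profile_flux_le.
  - exact/test_class_diff/profile_test.
  - by move=> v; exact: profile_derive.
rewrite ge0_integralD//; first last.
- exact/measurable_EFinP/measurable_funM.
- by move=> x _; rewrite -EFinM lee_fin mulr_ge0.
- exact/measurable_EFinP/measurable_funM.
- by move=> x _; rewrite -EFinM lee_fin !mulr_ge0.
rewrite ge0_integralZl//; first last.
- by move=> x _; rewrite lee_fin mulr_ge0.
- exact/measurable_EFinP.
rewrite ge0_integralZl//; first last.
- exact/measurable_EFinP.
rewrite integral_indic//; last exact: measurable_cube.
have -> : (\int[lebesgue3 R]_x (g x.1 * p x.2)%:E = (pi ^+ 3)%:E)%E.
  (* Tonelli is applied twice: first the third coordinate is split off, then the second. *)
  transitivity (\int[lebesgue2]_z (g z)%:E * \int[mu]_t (p t)%:E)%E.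
    exact: (@integral_tensor _ _ _ _ _ lebesgue2 mu g p mg mp g0 p0).
  transitivity ((\int[mu]_t (p t)%:E * \int[mu]_t (p t)%:E) * \int[mu]_t (p t)%:E)%E.
    by congr (_ * _)%E; exact: (@integral_tensor _ _ _ _ _ mu mu p p mp mp p0 p0).
  by rewrite integral_oneDsqrV -!EFinM; congr (_%:E); ring.
rewrite setIT lebesgue3_cube// -!EFinM -EFinD lee_fin le_eqVlt.
by apply/orP; left; apply/eqP; field; rewrite gt_eqF.
Qed.

(** A box inside the region |x| ~ 2^k replaces the dyadic spherical shell: its volume is an explicit
    product, and the half-open first side makes different boxes disjoint. *)
Definition shell (k : nat) : set (R3 R) :=
  (`[2 ^+ k, 2 ^+ k.+1[ `*` `[0, 2 ^+ k]) `*` `[0, 2 ^+ k].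

Lemma lebesgue3_shell k : lebesgue3 R (shell k) = (8 ^+ k)%:E.
Proof.
have k0 : 0 < 2 ^+ k :> R by rewrite exprn_gt0.
rewrite /shell lebesgue3_box// !lebesgue_measure_itv/= !lte_fin k0.
rewrite exprS ifT; last by lra.
rewrite -!EFinB -!EFinM (_ : 8 = 2 ^+ 3 :> R); last by ring.
by rewrite -exprM mulnC exprM; congr (_%:E); ring.
Qed.

Lemma measurable_shell k :
  measurable (shell k : set (measurableTypeR R * measurableTypeR R * measurableTypeR R)).
Proof. by apply: measurableX => //; exact: measurableX. Qed.

Lemma shell_inj j k x : shell j x -> shell k x -> j = k.
Proof.
move=> [[/= + _] _] [[/= kx _] _]; move: kx.
rewrite !in_itv/= => /andP[k1 k2] /andP[j1 j2].
have H m n : 2 ^+ m <= x.1.1 -> x.1.1 < 2 ^+ n.+1 -> (m <= n)%N.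
  move=> h1 h2; have : 2 ^+ m < 2 ^+ n.+1 :> R by exact: le_lt_trans h2.
  by rewrite ltr_eXn2l ?ltr1n// ltnS.
by apply/eqP; rewrite eqn_leq !H.
Qed.

Lemma sqnorm_shell k x : shell k x -> sqnorm x <= 6 * 4 ^+ k.
Proof.
move=> [[/=]]; rewrite !in_itv/= => /andP[a1 a2] /andP[b1 b2] /andP[c1 c2].
have k0 : 0 < 2 ^+ k :> R by rewrite exprn_gt0.
rewrite (_ : 4 = 2 ^+ 2 :> R); last by ring.
move: a1 a2; rewrite -exprM mulnC exprM exprS /sqnorm; nra.
Qed.

(** On the box, [profile] is bounded below by a multiple of w^3, and w is at least a multiple of
    2^-k; the result is proportional to the inverse volume of the box. *)
Lemma profile_shell_ge n k x : (k < n)%N -> shell k x ->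
  expR (-2) / 27 / 8 ^+ k <= profile ((2 ^+ n.+1) ^- 2) x.
Proof.
move=> kn kx; have s0 := sqnorm_ge0 x; have sk := sqnorm_shell _ _ kx.
have b0 := bracket_gt0 x.
have k0 : 0 < 2 ^+ k :> R by rewrite exprn_gt0.
have kE : 4 ^+ k = (2 ^+ k) ^+ 2 :> R.
  by rewrite (_ : 4 = 2 ^+ 2)//; [rewrite -!exprM mulnC|ring].
have k1 : 1 <= 2 ^+ k :> R by rewrite exprn_ege1// ler1n.
(* As k + 2 <= n + 1, the left side is at most 6/16. *)
have sM : (2 ^+ n.+1) ^- 2 * sqnorm x <= 2^-1.
  rewrite mulrC ler_pdivrMr ?exprn_gt0//; apply: le_trans sk _.
  case: n kn => // n; rewrite ltnS -(@ler_eXn2l R 2) ?ltr1n// => kn.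
  by rewrite kE !exprS; nra.
apply: (le_trans _ (profile_ge _ _ _ sM)); last by rewrite invr_ge0 sqr_ge0.
rewrite -!mulrA ler_pM2l ?expR_gt0//.
(* Indeed 1 + |x|^2 <= 1 + 6 * 4^k <= 9 * 4^k. *)
have bk : (3 * 2 ^+ k)^-1 <= bracket x.
  rewrite /bracket lef_pV2 ?posrE ?sqrtr_gt0 ?oneDsqnorm_gt0 ?mulr_gt0//.
  rewrite -(@ler_pXn2r _ 2)// ?nnegrE ?sqrtr_ge0 ?mulr_ge0// ?(ltW k0)//.
  by rewrite sqr_sqrtr ?ltW ?oneDsqnorm_gt0//; move: sk; rewrite kE; nra.
have -> : 27^-1 / 8 ^+ k = (3 * 2 ^+ k)^-1 ^+ 3 :> R.
  have -> : 8 ^+ k = (2 ^+ k) ^+ 3 :> R.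
    by rewrite (_ : 8 = 2 ^+ 3)//; [rewrite -!exprM mulnC|ring].
  by field; rewrite gt_eqF.
by rewrite ler_pXn2r// nnegrE ?(ltW b0)//.
Qed.

(** Each of the n disjoint boxes has volume 8^k and carries an integrand of at least exp(-2) / 27 /
    8^k, hence contributes the same amount. *)
Lemma integral_hedgehog_ge n :
  ((n%:R * (expR (-2) / 27))%:E <=
  \int[lebesgue3 R]_x (norm1 (hedgehog (profile ((2 ^+ n.+1) ^- 2)) x) / enorm x)%:E)%E.
Proof.
pose T := (measurableTypeR R * measurableTypeR R * measurableTypeR R)%type.
set h := profile _; set c := expR (-2) / 27.
have c0 : 0 < c by rewrite divr_gt0 ?expR_gt0.
have ck k : 0 <= c / 8 ^+ k by rewrite divr_ge0 ?exprn_ge0 ?(ltW c0).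
pose L (x : T) := (\sum_(k < n) (c / 8 ^+ k)%:E * (\1_(shell k) x)%:E)%E.
have mi k : measurable_fun setT (\1_(shell k : set T) : T -> R).
  by apply: measurable_indic; exact: measurable_shell.
have L0 x : (0 <= L x)%E by apply: sume_ge0 => k _; rewrite -EFinM lee_fin mulr_ge0.
have LE : (\int[lebesgue3 R]_x L x = (n%:R * c)%:E)%E.
  rewrite ge0_integral_sum//; first last.
  - by move=> k x _; rewrite -EFinM lee_fin mulr_ge0.
  - by move=> k; exact/measurable_EFinP/measurable_funM.
  rewrite (eq_bigr (fun=> c%:E)); last first.
    move=> k _; rewrite ge0_integralZl//; first last.
    - by rewrite lee_fin.
    - exact/measurable_EFinP.
    rewrite integral_indic//; last exact: measurable_shell.
    by rewrite setIT lebesgue3_shell -EFinM divfK// expf_neq0.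
  by rewrite sumEFin sumr_const card_ord mulr_natl.
rewrite -LE; apply: ge0_le_integral_nonmeasurable => // x.
have r0 : 0 <= norm1 (hedgehog h x) / enorm x.
  by rewrite divr_ge0 ?sqrtr_ge0// norm1_ge0.
(* By disjointness at most one term of [L x] is nonzero. *)
have [[k kx]|nx] := pselect (exists k : 'I_n, shell k x); last first.
  rewrite /L big1// => k _; rewrite indicE memNset ?mule0//.
  by move=> kx; apply: nx; exists k.
rewrite /L (bigD1 k)//= big1 ?adde0; last first.
  move=> j jk; rewrite indicE memNset ?mule0// => jx.
  by move/eqP: jk; apply; apply/val_inj; exact: (shell_inj _ _ _ jx kx).
rewrite -EFinM indicE mem_set// mulr1 lee_fin.
have h0 := profile_ge0 ((2 ^+ n.+1) ^- 2) x.
apply: le_trans (profile_shell_ge _ _ _ (ltn_ord k) kx) _.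
(* On a box x_1 >= 2^k, so the point is away from the origin and dividing by |x| is genuine. *)
have e0 : 0 < enorm x.
  rewrite sqrtr_gt0; have [+ _ _] := sqr_le_sqnorm x; apply: lt_le_trans.
  case: kx => [[/=]]; rewrite in_itv/= => /andP[xk _] _ _.
  by rewrite exprn_gt0// (lt_le_trans _ xk)// exprn_gt0.
by rewrite ler_pdivlMr//; exact: norm1_hedgehog_ge.
Qed.

End Integrals.

Theorem mainTheorem4 (R : realType) :
  ~ exists C : R, 0 < C /\
      forall f : R * R * R -> 'cV[R[i]]_2, C0oo f ->
        (\int[lebesgue3 R]_x (norm1 (f x) / enorm x)%:E
         <= C%:E * \int[lebesgue3 R]_x (norm1 (sigma_p f x))%:E)%E.
Proof.
move=> [C [C0 H]].
pose c : R := expR (-2) / 27; have c0 : 0 < c by rewrite divr_gt0 ?expR_gt0.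
pose K : R := C * (15 / 2 * pi ^+ 3 + 320).
(* Enough scales that n c exceeds [K], the bound on the right-hand side, which does not depend on
   n. *)
pose n := (Num.truncn (K / c)).+1.
have M1 : 1 <= 2 ^+ n.+1 :> R by rewrite exprn_ege1// ler1n.
have : ((n%:R * c)%:E <= K%:E :> \bar R)%E.
  apply: le_trans (integral_hedgehog_ge n) _.
  apply: le_trans (H _ (hedgehog_profile_C0oo _ M1)) _.
  by rewrite EFinM lee_pmul2l ?lte_fin//; exact: integral_flux_le.
rewrite lee_fin -ler_pdivlMr// leNgt => /negP; apply.
exact: truncnS_gt.
Qed.
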